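(* Let $0<p\leq q\leq\infty$. A subconvex operator $T:L^p(\mathbb{R}_+)_+ + L^q(\mathbb{R}_+)_+\to S(\mathbb{R}_+)$ is simultaneously of Marcinkiewicz weak types $(p,p)$ and $(q,q)$, i.e., there are constants $C_p,C_q>0$ such that $$\|Tf\|_{L^{r,\infty}(\mathbb{R}_+)}\leq C_r\|f\|_{L^r(\mathbb{R}_+)}\qquad (f\in L^r(\mathbb{R}_+)_+,\ r=p,q),$$ if and only if there is some $\alpha>0$ such that for all $f\in L^p(\mathbb{R}_+)_+ + L^q(\mathbb{R}_+)_+$, $$d(\alpha v;Tf)\leq d(v;\Theta_{p,q}(f))\qquad (v>0).$$
   Context: Let $\lambda$ be Lebesgue measure (on $\mathbb{R}_+$ or $\mathbb{R}_+\times\mathbb{R}_+$). For a measurable a.e. finite $f$, $d(v;f)=\lambda(|f|>v)\in[0,\infty]$, $v\ge0$. $S(\mathbb{R}_+)$ is the space of measurable a.e. finite functions $f$ on $\mathbb{R}_+$ with $d(v;f)<\infty$ for some $v>0$; $\mu_t(f)=\inf\{v>0:d(v;f)\le t\}$. $X_+$ denotes the nonnegative elements of a function space $X$. For $0<r<\infty$, $\|f\|_{L^{r,\infty}}=\sup_{t>0}t^{1/r}\mu_t(f)=\sup_{v>0}v\,d(v;f)^{1/r}$; $L^{\infty,\infty}=L^\infty$. An operator $T:D\to S(\mathbb{R}_+)$ on a convex set $D\subset S(\mathbb{R}_+)$ is called subconvex if $T(tf+(1-t)g)\le tT(f)+(1-t)T(g)$ for all $f,g\in D$ and $t\in[0,1]$.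 For $0<p,q\le\infty$ put $\theta_{p,q}(t)=t^{-1/q}\chi_{(0,1)}(t)+t^{-1/p}\chi_{[1,\infty)}(t)$ for $t>0$ (with $t^{-1/\infty}=1$), and $\Theta_{p,q}(f)=f\otimes\theta_{p,q}$, i.e. the function $(s,t)\mapsto f(s)\theta_{p,q}(t)$ on $\mathbb{R}_+\times\mathbb{R}_+$.
   Formalization: For p<q the map f ↦ |Tf| is also assumed subconvex (automatic if Tf ≥ 0 or T is linear). Without it the claim fails: Tf = −h for f in neither L^p nor L^q, Tf = 0 otherwise, is subconvex and of both weak types, but violates the estimate for suitable h ≥ 0. *)

(* Defs.v *)
From HB Require Import structures.
From mathcomp Require Import all_boot all_order all_algebra.
From mathcomp Require Import all_classical all_reals all_analysis.
From mathcomp Require Import measurable_realfun ess_sup_inf.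

Set Implicit Arguments.
Unset Strict Implicit.
Unset Printing Implicit Defensive.

Import Order.TTheory GRing.Theory Num.Theory.
Import numFieldNormedType.Exports.

Local Open Scope classical_set_scope.
Local Open Scope ring_scope.
Local Open Scope ereal_scope.

(* Function spaces are sets of measurable functions with values in \bar R,
   not sets of classes modulo a.e. equality; the order between functions is
   the a.e. order.  An operator on functions need not respect a.e. equality;
   those that do are the operators on classes. *)
Section FunctionSpaces.
Context {d : measure_display} {X : measurableType d} {R : realType}.
Variable mu : {measure set X -> \bar R}.
Implicit Types (f g : X -> \bar R) (p q r : \bar R).

Definition distribution_fun f (v : R) : \bar R :=
  mu [set x | v%:E < `|f x|].

Definition space_S : set (X -> \bar R) :=
  [set f : X -> \bar R | [/\ measurable_fun [set: X] f,
               (\forall x \ae mu, f x \is a fin_num) &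
               exists2 v : R, (0 < v)%R & distribution_fun f v < +oo]].

Definition rearrangement f (t : R) : \bar R :=
  ereal_inf [set v%:E | v in
    [set v : R | (0 < v)%R /\ distribution_fun f v <= t%:E]].

(* L^{oo,oo} = L^oo; the value at r = -oo is irrelevant. *)
Definition weakLnorm r f : \bar R :=
  match r with
  | s%:E => ereal_sup [set (t `^ s^-1)%:E * rearrangement f t | t in
              [set t : R | (0 < t)%R]]
  | _ => 'N[mu]_r[f]
  end.

Definition Lspace_pos p : set (X -> \bar R) :=
  [set f : X -> \bar R | [/\ measurable_fun [set: X] f,
               'N[mu]_p[f] < +oo &
               \forall x \ae mu, 0 <= f x]].

Definition Lsum_pos p q : set (X -> \bar R) :=
  [set f0 \+ f1 | f0 in Lspace_pos p & f1 in Lspace_pos q].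

Definition subconvex (D : set (X -> \bar R))
    (T : (X -> \bar R) -> (X -> \bar R)) : Prop :=
  forall f g (t : R), D f -> D g -> (0 <= t <= 1)%R ->
    \forall x \ae mu,
      T (fun y => t%:E * f y + (1 - t)%:E * g y) x
        <= t%:E * T f x + (1 - t)%:E * T g x.

(* If T f may be negative, subconvexity bounds T only from above, whereas
   distribution_fun and weakLnorm see |T f|.  On L^p_+ + L^q_+ with p < q, the
   map sending f to a fixed -h when f is in neither L^p nor L^q, and to 0
   otherwise, is subconvex and of both weak types with any constants, for every
   h >= 0.  Subconvexity of f |-> |T f| excludes it; when T f >= 0 for all f
   this is subconvexity of T itself, and it is automatic when T is linear. *)
Definition abs_operator (T : (X -> \bar R) -> (X -> \bar R)) :=
  fun f x => `|T f x|.

Definition weak_type (T : (X -> \bar R) -> (X -> \bar R)) r : Prop :=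
  exists2 C : R, (0 < C)%R &
    forall f, Lspace_pos r f -> weakLnorm r (T f) <= C%:E * 'N[mu]_r[f].

End FunctionSpaces.

Section HalfLine.
Variable R : realType.

Let Rp : set (measurableTypeR R) := `[0%R, +oo[.
Let mRp : measurable Rp := measurable_itv `[0%R, +oo[.

(* Lebesgue measure on R_+ = [0, +oo[ and on R_+ x R_+, as measures on R and
   R * R concentrated there. *)
Definition lambda : {measure set (measurableTypeR R) -> \bar R} :=
  mrestr (@lebesgue_measure R) mRp.

Definition lambda2 :
    {measure set (measurableTypeR R * measurableTypeR R) -> \bar R} :=
  mrestr (@lebesgue_measure R \x @lebesgue_measure R) (measurableX mRp mRp).

(* The inverse is that of \bar R, for which +oo^-1 = 0. *)
Definition theta (p q : \bar R) (t : R) : R :=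
  (t `^ (- fine (q^-1)%E) * \1_(`]0%R, 1%R[%classic) t
   + t `^ (- fine (p^-1)%E) * \1_(`[1%R, +oo[%classic) t)%R.

Definition Theta (p q : \bar R) (f : R -> \bar R) : R * R -> \bar R :=
  fun z => f z.1 * (theta p q z.2)%:E.

End HalfLine.
Arguments lambda {R}.
Arguments lambda2 {R}.

(* Main.v *)
(* Write a = |f(s)| / v.  The section at s of {|Theta_{p,q} f| > v} has measure
   a^p if a > 1 and a^q if a <= 1, so d(v; Theta_{p,q} f) is the sum of the
   p-modular of f 1_{|f| > v} / v and the q-modular of f 1_{|f| <= v} / v, where
   the r-modular of g is the integral of |g|^r (if r = oo, of oo * 1_{|g| > 1}).
   On the other hand weak type (r, r) with constant C says exactly that
   d(C v; T f) is at most the r-modular of f / v.  Weak types therefore give the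
   distribution inequality by applying subconvexity to the decomposition
   f = (2 f 1_{|f| > v}) / 2 + (2 f 1_{|f| <= v}) / 2, and conversely
   d(v; Theta_{p,q} f) is bounded by both modulars of f / v, because p <= q. *)

Require Import Defs.
From HB Require Import structures.
From mathcomp Require Import all_boot all_order all_algebra.
From mathcomp Require Import all_classical all_reals all_analysis.
From mathcomp Require Import measurable_realfun ess_sup_inf.

Set Implicit Arguments.
Unset Strict Implicit.
Unset Printing Implicit Defensive.

Import Order.TTheory GRing.Theory Num.Theory.
Import numFieldNormedType.Exports.

Local Open Scope classical_set_scope.
Local Open Scope ring_scope.
Local Open Scope ereal_scope.

(** * Gauge functions, the integrands of the modulars *)

(** At [r = +oo] and [0 <= a] this is the limit of [a ^ s] as [s] tends to infinity, except at
    [a = 1], where the value 0 matches the strict inequality in [distribution_fun]. *)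
Definition gauge (R : realType) (r a : \bar R) : \bar R :=
  if r is s%:E then a `^ s else if 1 < a then +oo else 0.

Section Gauge.
Variable R : realType.
Implicit Types (r a b : \bar R).

Lemma gauge_ge0 r a : 0 <= gauge r a.
Proof. by case: r => [s||] /=; rewrite ?poweR_ge0//; case: ifP. Qed.

Lemma gauge0 r : 0 < r -> gauge r 0 = 0.
Proof.
by case: r => [s||] //= s0; [rewrite powR0// gt_eqF|rewrite ltNge lee01].
Qed.

Lemma gauge_lty r a : 0 < r -> gauge r a < +oo -> a < +oo.
Proof.
case: r => [s||] //= s0; first by apply: lty_poweRy; rewrite gt_eqF.
case: ifP => // /negbT; rewrite -leNgt => a1 _.
by rewrite (le_lt_trans a1) ?ltry.
Qed.

Lemma le_gauge_exponent_le1 p q a :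
  0 < p -> p <= q -> 0 <= a <= 1 -> gauge q a <= gauge p a.
Proof.
move=> p0 pq /andP[a0 a1]; case: q pq => [q pq|_|]; last by case: p p0.
  case: p p0 pq => [p||] //= p0 pq.
  case: a a0 a1 => [a||] //=; rewrite !lee_fin => a0 a1.
  have [->|aN0] := eqVneq a 0%R.
    by rewrite !powR0 ?gt_eqF// -lte_fin (lt_le_trans p0 pq).
  by rewrite ger_powR// lt0r aN0 a0.
by rewrite /= ltNge a1 /= gauge_ge0.
Qed.

Lemma le_gauge_exponent_gt1 p q a :
  0 < p -> p <= q -> 1 < a -> gauge p a <= gauge q a.
Proof.
move=> p0 pq a1; case: q pq => [q pq|_|]; last by case: p p0.
  case: p p0 pq => [p||] //= p0 pq.
  case: a a1 => [a||] //= a1; last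
    by rewrite !gt_eqF// -lte_fin (lt_le_trans p0 pq).
  by rewrite lee_fin ler_powR// ltW.
by rewrite /= a1 leey.
Qed.

Lemma measurable_gauge r : measurable_fun [set: \bar R] (gauge r).
Proof.
case: r => [s||] /=; first exact: measurable_poweR.
  apply: measurable_fun_ifT => //.
  exact: measurable_fun_lte.
by apply: measurable_fun_ifT => //; exact: measurable_fun_lte.
Qed.

End Gauge.

(** * Modulars in terms of norms, and weak norms in terms of distribution functions *)

Definition modular d (X : measurableType d) (R : realType)
    (mu : {measure set X -> \bar R}) (r : \bar R) (v : R) (f : X -> \bar R) :=
  \int[mu]_x gauge r (v^-1%:E * `|f x|).

Lemma lte_EFin_between (R : realType) (a : R) (b : \bar R) :
  a%:E < b -> exists2 c : R, (a < c)%R & c%:E < b.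
Proof.
case: b => [b ab||] //; last by exists (a + 1)%R; rewrite ?ltrDl// ltry.
by exists ((a + b) / 2)%R; rewrite ?lte_fin midf_lt.
Qed.

Section Modular.
Context d (X : measurableType d) (R : realType).
Variable mu : {measure set X -> \bar R}.
(** The definition of ['N[mu]_+oo] branches on this condition; under it the norm is the essential
    supremum. *)
Hypothesis muT_gt0 : 0 < mu [set: X].
Implicit Types (f g : X -> \bar R) (r : \bar R) (v w : R).

Lemma measurable_superlevel f v : measurable_fun [set: X] f ->
  measurable [set x | v%:E < `|f x|].
Proof.
move=> mf; rewrite -[X in measurable X]setTI.
by apply: emeasurable_fun_o_infty => //; exact: measurableT_comp.
Qed.

Lemma distribution_fun_eq0 f v : measurable_fun [set: X] f ->
  distribution_fun mu f v = 0 <-> ess_sup mu (abse \o f) <= v%:E.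
Proof.
move=> mf; rewrite -(rwP ess_supP).
rewrite /distribution_fun -(negligibleP _ (measurable_superlevel v mf)).
rewrite /prop_near1 /nbhs/= /almost_everywhere.
rewrite (_ : ~` _ = [set x | v%:E < `|f x|])//.
by apply/seteqP; split=> x /=; rewrite ltNge => /negP.
Qed.

Lemma le_distribution_fun f v w : measurable_fun [set: X] f -> (v <= w)%R ->
  distribution_fun mu f w <= distribution_fun mu f v.
Proof.
move=> mf vw; apply: le_measure; rewrite ?inE; try exact: measurable_superlevel.
by move=> x /=; apply: le_lt_trans; rewrite lee_fin.
Qed.

Lemma lte1_scale v (a : \bar R) : (0 < v)%R -> (1 < v^-1%:E * a) = (v%:E < a).
Proof. by move=> v0; rewrite lte_pdivlMl// mule1. Qed.

Lemma scaled_abse_ge0 f v x : (0 < v)%R -> 0 <= v^-1%:E * `|f x|.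
Proof. by move=> v0; rewrite mule_ge0// lee_fin invr_ge0 ltW. Qed.

Lemma measurable_gauge_scale r v f : measurable_fun [set: X] f ->
  measurable_fun [set: X] (fun x => gauge r (v^-1%:E * `|f x|)).
Proof.
move=> mf; apply: (measurableT_comp (measurable_gauge r)).
by apply: measurable_funeM; exact: measurableT_comp.
Qed.

(** For finite [r] this is homogeneity of the integral. For [r = +oo] the integrand is [+oo] on {|f|
    > v} and 0 elsewhere, so the integral is [+oo] or 0 according to whether that set has positive
    measure, that is, whether the essential supremum exceeds [v]. *)
Lemma modularE r v f : 0 < r -> (0 < v)%R -> measurable_fun [set: X] f ->
  modular mu r v f = gauge r (v^-1%:E * 'N[mu]_r[f]).
Proof.
case: r => [s||]// s0 v0 mf; rewrite /modular /gauge.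
  have vi0 : (0 <= v^-1)%R by rewrite invr_ge0 ltW.
  under eq_integral do rewrite poweRM//.

  rewrite poweRM ?Lnorm_ge0// poweR_Lnorm ?gt_eqF// poweR_EFin.
  rewrite ge0_integralZl_EFin//.
  - by move=> x _; exact: poweR_ge0.
  - apply: (measurableT_comp (measurable_poweR s)).
    exact: measurableT_comp.
  - exact: powR_ge0.
under eq_integral do rewrite lte1_scale//.
rewrite lte1_scale// unlock muT_gt0 ltNge.
transitivity (\int[mu]_(x in [set x | v%:E < `|f x|]) cst +oo x).
  rewrite [RHS]integral_mkcond; apply: eq_integral => x _.
  rewrite /patch; case: ifPn => vf; first by rewrite mem_set.
  by rewrite memNset//=; exact/negP.
rewrite integral_cst; last exact: measurable_superlevel.
case: ifPn => [/negP|].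
  rewrite -distribution_fun_eq0// => d0.
  by rewrite gt0_mulye// lt0e measure_ge0 andbT; exact/eqP.
rewrite negbK -distribution_fun_eq0// => d0.
by rewrite [X in _ * X]d0 mule0.
Qed.

Lemma modular_lty_Lspace r v f : 0 < r -> (0 < v)%R ->
  measurable_fun [set: X] f -> (\forall x \ae mu, 0 <= f x) ->
  modular mu r v f < +oo -> Lspace_pos mu r f.
Proof.
move=> r0 v0 mf f0; rewrite modularE// => /(gauge_lty r0).
rewrite lte_pdivrMl// => Nf; split => //.
by rewrite (lt_le_trans Nf)// leey.
Qed.

Lemma modular_scale r c v f : (0 < c)%R -> (0 < v)%R ->
  modular mu r (c * v) (fun x => c%:E * f x) = modular mu r v f.
Proof.
move=> c0 v0; apply: eq_integral => x _; congr gauge.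
rewrite abseM gee0_abs ?lee_fin ?ltW// muleA -EFinM invfM.
by rewrite mulrAC mulVf ?mul1r// gt_eqF.
Qed.

(** [rearrangement] is the generalized inverse of [distribution_fun], so a bound on all t^(1/s)
    mu_t(g) turns into a bound on all levels of the distribution function, with the same constant
    [M]. *)
Lemma weakLnorm_leP r g (M : R) : 0 < r -> (0 <= M)%R ->
  measurable_fun [set: X] g ->
  weakLnorm mu r g <= M%:E <->
  forall w, (0 < w)%R -> distribution_fun mu g w <= gauge r (w^-1 * M)%:E.
Proof.
case: r => [s||]// s0 M0 mg /=; last first.
  rewrite unlock muT_gt0; split=> [gM w w0|gM].
    case: ifPn => [|]; first by rewrite leey.
    rewrite EFinM lte1_scale// -leNgt => Mw.
    by rewrite (distribution_fun_eq0 _ mg).2//; exact: le_trans Mw.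
  (* The level [M + e] is positive even when [M = 0], so [gM] applies to it. *)
  apply/lee_addgt0Pr => e e0.
  have Me0 : (0 < M + e)%R by rewrite ltr_wpDl.
  rewrite -EFinD -distribution_fun_eq0//; apply/eqP.
  rewrite eq_le measure_ge0 andbT (le_trans (gM _ Me0))//.
  by rewrite EFinM lte1_scale// lte_fin ltNge lerDl (ltW e0).
have s'0 : (s != 0)%R by rewrite gt_eqF.
split=> [gM w w0|gM].
  (* Take [t] strictly between (M/w)^s and d(w; g). No level below [w] is admissible in the infimum
     defining mu_t(g), so mu_t(g) >= w; then t^(1/s) w <= M contradicts (M/w)^s < t. *)
  rewrite leNgt; apply/negP => /lte_EFin_between[t /= Mt td].
  have t0 : (0 < t)%R by rewrite (le_lt_trans _ Mt)// powR_ge0.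
  have wt : w%:E <= rearrangement mu g t.
    apply: le_ereal_inf_tmp => _ [v [v0 dv] <-]; rewrite lee_fin leNgt.
    apply/negP => vw; have := le_lt_trans dv td.
    by rewrite ltNge le_distribution_fun// ltW.
  have : (t `^ s^-1)%:E * w%:E <= M%:E.
    apply: le_trans gM; apply: (@le_trans _ _ ((t `^ s^-1)%:E *
        rearrangement mu g t)).
      by rewrite lee_wpmul2l// lee_fin powR_ge0.
    by apply: ereal_sup_ubound; exists t.
  rewrite -EFinM lee_fin leNgt => /negP; apply.
  have wM0 : (0 <= w^-1 * M)%R by rewrite mulr_ge0// invr_ge0 ltW.
  have : ((w^-1 * M) `^ s `^ s^-1 < t `^ s^-1)%R.
    by rewrite gt0_ltr_powR// ?nnegrE ?powR_ge0 ?(ltW t0)// invr_gt0.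
  by rewrite -powRrM mulfV// powRr1// ltr_pdivrMl// mulrC.
apply: ge_ereal_sup => _ [t /= t0 <-]; apply/lee_addgt0Pr => e e0.
have ts0 : (0 < t `^ s^-1)%R by exact: powR_gt0.
(* Chosen so that t^(1/s) w = M + e and (M/w)^s <= t; the summand [e] keeps [w] positive when
   [M = 0]. *)
pose w := ((M + e) / t `^ s^-1)%R.
have w0 : (0 < w)%R by rewrite divr_gt0// ltr_wpDl.
apply: (@le_trans _ _ ((t `^ s^-1)%:E * w%:E)); last first.
  by rewrite -EFinM /w mulrCA divff ?gt_eqF// mulr1 EFinD.
rewrite lee_pmul2l// ?lte_fin//; apply: ereal_inf_lbound; exists w => //.
split=> //; apply: (le_trans (gM _ w0)).
rewrite lee_fin -[leRHS]powRr1 ?(ltW t0)// -(mulVf s'0) powRrM.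
have wM0 : (0 <= w^-1 * M)%R by rewrite mulr_ge0// invr_ge0 ltW.
apply: ge0_ler_powR; rewrite ?nnegrE ?powR_ge0 //; first exact: (ltW s0).
rewrite /w invf_div mulrAC ler_pdivrMr ?ltr_wpDl//.
by rewrite ler_wpM2l ?powR_ge0// lerDl (ltW e0).
Qed.

End Modular.

(** * Lebesgue measure on the half-line and the distribution function of [Theta] *)

Lemma sigma_finite_mrestr d (X : measurableType d) (R : realType)
    (mu : {sigma_finite_measure set X -> \bar R}) (D : set X)
    (mD : measurable D) : sigma_finite [set: X] (mrestr mu mD).
Proof.
have [F FT mF] := sigma_finiteT mu; exists F => // i.
have [mFi Fioo] := mF i; split => //; apply: le_lt_trans Fioo.
by apply: le_measure; rewrite ?inE//; exact: measurableI.
Qed.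

Section ThetaDistribution.
Variable R : realType.
Implicit Types (p q r a b : \bar R) (f : R -> \bar R) (t v : R).

(* An alias of lambda, as a key for the sigma-finite measure structure. *)
Definition lambda_sf : set (measurableTypeR R) -> \bar R := lambda.

HB.instance Definition _ := Measure.copy lambda_sf (@lambda R).

Lemma sigma_finite_lambda : sigma_finite [set: measurableTypeR R] lambda_sf.
Proof. exact: sigma_finite_mrestr. Qed.

HB.instance Definition _ :=
  @Measure_isSigmaFinite.Build _ _ R lambda_sf sigma_finite_lambda.

Lemma lambda_setT : lambda [set: R] = +oo.
Proof.
by rewrite /lambda/= /mrestr setTI lebesgue_measure_itv/= ltry.
Qed.

(** [lambda2] is a restricted product rather than a product of restrictions. The two agree on
    measurable rectangles, hence everywhere by uniqueness of the product measure, which is computed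
    by sections. *)
Lemma lambda2E (A : set (measurableTypeR R * measurableTypeR R)) :
  measurable A -> lambda2 A = \int[lambda]_x lambda (xsection A x).
Proof.
move=> mA.
rewrite -(@product_measure_unique _ _ _ _ _ lambda_sf lambda_sf lambda2)//.
move=> B C mB mC; rewrite /lambda2/= /mrestr -setXI product_measure1E//.
  exact: measurableI.
exact: measurableI.
Qed.

Lemma fine_inve_ge0 r : 0 < r -> (0 <= fine (r^-1)%E)%R.
Proof. by move=> r0; rewrite fine_ge0// inve_ge0 ltW. Qed.

(** For finite r = s and finite [b] the set is the interval ]0, b^s[. If [b] or [r] is infinite, it
    is either ]0, +oo[ or empty. *)
Lemma lambda_power_superlevel r b : 0 < r -> 0 <= b ->
  lambda [set t : R | (0 < t)%R /\ 1 < b * (t `^ (- fine (r^-1)%E))%:E]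
  = gauge r b.
Proof.
have lambda_oo : lambda `]0%R, +oo[%classic = +oo :> \bar R.
  rewrite /lambda/= /mrestr (_ : _ `&` _ = `]0%R, +oo[%classic).
    by rewrite lebesgue_measure_itv/= ltry.
  by apply/setIidPl => t /=; rewrite !in_itv/= !andbT => /ltW.
move=> r0 b0.
have [->|boo] := eqVneq b +oo.
  rewrite (_ : gauge r +oo = +oo); last first.
    by case: r r0 => [s||]//= s0; rewrite ?gt_eqF// ltry.
  rewrite -[RHS]lambda_oo; congr (lambda _); apply/seteqP; split => t /=.
    by rewrite in_itv/= andbT => -[].
  rewrite in_itv/= andbT => t0; split => //.
  by rewrite gt0_mulye ?ltry// lte_fin powR_gt0.
have bfin : b \is a fin_num by rewrite ge0_fin_numE// ltey.
case: r r0 => [s||]// s0; last first.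
  rewrite invey oppr0 /gauge.
  have [b1|b1] := ltP 1 b.
    rewrite -[RHS]lambda_oo; congr (lambda _); apply/seteqP; split => t /=.
      by rewrite in_itv/= andbT => -[].
    by rewrite in_itv/= andbT => t0; rewrite powRr0 mule1.
  rewrite -[RHS](measure0 (@lambda R)); congr (lambda _).
  by apply/seteqP; split => t //= [_]; rewrite powRr0 mule1 ltNge b1.
have s'0 : (0 < s)%R by rewrite -lte_fin.
have sN0 : (s != 0)%R by rewrite gt_eqF.
rewrite inver gt_eqF//= -(fineK bfin) /=.
move: (fine b) (fine_ge0 b0) => c c0 {b b0 boo bfin}.
have <- : lambda `]0%R, (c `^ s)%R[%classic = (c `^ s)%:E.
  rewrite /lambda/= /mrestr (_ : _ `&` _ = `]0%R, (c `^ s)%R[%classic).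
    rewrite lebesgue_measure_itv/= lte_fin.
    have := powR_ge0 c s; rewrite le_eqVlt => /predU1P[<-|->].
      by rewrite ltxx.
    by rewrite oppr0 adde0.
  by apply/setIidPl => t /=; rewrite !in_itv/= !andbT => /andP[/ltW].
congr (lambda _); apply/seteqP; split => t /=; rewrite in_itv/=.
  move=> [t0]; rewrite t0/= -EFinM lte_fin powRN.
  rewrite ltr_pdivlMr ?powR_gt0// mul1r => tc.
  rewrite -[ltLHS]powRr1 ?(ltW t0)// -(mulVf sN0) powRrM.
  by rewrite gt0_ltr_powR// ?nnegrE ?powR_ge0.
move=> /andP[t0 tc]; split => //.
rewrite -EFinM lte_fin powRN ltr_pdivlMr ?powR_gt0// mul1r.
rewrite -[ltRHS]powRr1// -(mulfV sN0) powRrM.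
by rewrite gt0_ltr_powR// ?nnegrE ?powR_ge0 ?(ltW t0)// invr_gt0.
Qed.


Lemma theta_lt1 p q t : (0 < t < 1)%R ->
  theta p q t = (t `^ (- fine (q^-1)%E))%R.
Proof.
move=> /andP[t0 t1]; rewrite /theta !indicE.
have t01 : `]0%R, 1%R[%classic t by rewrite /= in_itv/= t0 t1.
have t1' : ~ `[1%R, +oo[%classic t by rewrite /= in_itv/= leNgt t1.
by rewrite (mem_set t01) (memNset t1') mulr1 mulr0 addr0.
Qed.

Lemma theta_ge1 p q t : (1 <= t)%R -> theta p q t = (t `^ (- fine (p^-1)%E))%R.
Proof.
move=> t1; rewrite /theta !indicE.
have t01 : ~ `]0%R, 1%R[%classic t.
  by rewrite /= in_itv/= => /andP[_]; rewrite ltNge t1.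
have t1' : `[1%R, +oo[%classic t by rewrite /= in_itv/= andbT.
by rewrite (memNset t01) (mem_set t1') mulr1 mulr0 add0r.
Qed.

Lemma theta0 p q : theta p q 0 = 0%R.
Proof.
rewrite /theta !indicE.
have t01 : ~ `]0%R, 1%R[%classic (0 : R)%R by rewrite /= in_itv/= ltxx.
have t1 : ~ `[1%R, +oo[%classic (0 : R)%R by rewrite /= in_itv/= ler10.
by rewrite (memNset t01) (memNset t1) !mulr0 addr0.
Qed.

Lemma theta_ge0 p q t : (0 <= theta p q t)%R.
Proof. by rewrite addr_ge0// mulr_ge0// powR_ge0. Qed.

Lemma measurable_theta p q : measurable_fun [set: R] (theta p q).
Proof.
by apply: measurable_funD; apply: measurable_funM => //; exact: measurable_powR.
Qed.

Lemma measurable_Theta p q f : measurable_fun [set: R] f ->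
  measurable_fun [set: R * R] (Theta p q f).
Proof.
move=> mf; apply: emeasurable_funM.
  exact: measurableT_comp mf measurable_fst.
apply/measurable_EFinP.
exact: measurableT_comp (measurable_theta p q) measurable_snd.
Qed.

Lemma powRN_ge1 r t : 0 < r -> (0 < t <= 1)%R ->
  (1 <= t `^ (- fine (r^-1)%E))%R.
Proof.
move=> r0 t01; rewrite -[leLHS](powRr0 t); apply: ger_powR => //.
by rewrite oppr_le0 fine_inve_ge0.
Qed.

Lemma powRN_le1 r t : 0 < r -> (1 <= t)%R ->
  (t `^ (- fine (r^-1)%E) <= 1)%R.
Proof.
move=> r0 t1; rewrite -[leRHS](powRr0 t); apply: ler_powR => //.
by rewrite oppr_le0 fine_inve_ge0.
Qed.

(** Only one of the two branches of [theta] matters. If a > 1, every t in ]0, 1[ satisfies the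
    inequality with either exponent, so [q] may be replaced by [p] there; if a <= 1, no t >= 1
    satisfies it with either exponent, so [p] may be replaced by [q] there. *)
Lemma theta_superlevel p q a t : 0 < p -> 0 < q -> 0 <= a -> (0 <= t)%R ->
  1 < a * (theta p q t)%:E <->
  (0 < t)%R /\ 1 < a * (t `^ (- fine ((if 1%E < a then p else q)^-1)%E))%:E.
Proof.
move=> p0 q0 a0; rewrite le_eqVlt => /predU1P[<-|t0].
  by rewrite theta0 mule0 ltxx ltNge lee01; split=> // -[].
have [a1|a1] := ltP 1 a; have [t1|t1] := ltP t 1%R.
- rewrite theta_lt1 ?t0//; split=> [_|_]; last first.
    apply: lt_le_trans a1 _; rewrite -[leLHS]mule1 lee_wpmul2l//.
    by rewrite lee_fin powRN_ge1// t0 ltW.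
  split=> //; apply: lt_le_trans a1 _; rewrite -[leLHS]mule1 lee_wpmul2l//.
  by rewrite lee_fin powRN_ge1// t0 ltW.
- by rewrite theta_ge1//; split=> // -[].
- by rewrite theta_lt1 ?t0//; split=> // -[].
- rewrite theta_ge1//.
  have aN (r : \bar R) : 0 < r -> ~~ (1 < a * (t `^ (- fine (r^-1)%E))%:E).
    move=> r0; rewrite -leNgt; apply: le_trans a1.
    by rewrite -[leRHS]mule1 lee_wpmul2l// lee_fin powRN_le1.
  by split=> [|[_]] /=; rewrite ?(negbTE (aN _ p0)) ?(negbTE (aN _ q0)).
Qed.

Lemma distribution_Theta p q f v : 0 < p -> 0 < q -> (0 < v)%R ->
  measurable_fun [set: R] f ->
  distribution_fun lambda2 (Theta p q f) v =
  \int[lambda]_x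
    gauge (if 1 < v^-1%:E * `|f x| then p else q) (v^-1%:E * `|f x|).
Proof.
move=> p0 q0 v0 mf; rewrite /distribution_fun lambda2E; last first.
  by apply: measurable_superlevel; exact: measurable_Theta.
apply: eq_integral => x _.
set a := v^-1%:E * `|f x|.
have a0 : 0 <= a by exact: scaled_abse_ge0.
rewrite -lambda_power_superlevel//; last by case: ifP.
have sectionE t : xsection [set z | v%:E < `|Theta p q f z|] x t <->
    1 < a * (theta p q t)%:E.
  rewrite xsectionE /= /Theta/=.
  rewrite abseM [`|(_)%:E|]gee0_abs ?lee_fin ?theta_ge0//.
  by rewrite -lte1_scale// muleA.
(* The two sets are compared only inside [0, +oo[, which supplies the condition [0 <= t] of
   [theta_superlevel]. *)
rewrite /lambda/= /mrestr; congr lebesgue_measure.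
apply/seteqP; split=> t [] /= st t0; (split; last by []);
  have t0' : (0 <= t)%R by move: t0; rewrite in_itv/= andbT.
  by apply/(theta_superlevel p0 q0 a0 t0').1/sectionE.
by apply/sectionE/(theta_superlevel p0 q0 a0 t0').2.
Qed.

End ThetaDistribution.

(** * The positive cones, and weak type in terms of modulars *)

Section WeakType.
Context d (X : measurableType d) (R : realType).
Variable mu : {measure set X -> \bar R}.
Implicit Types (f g : X -> \bar R) (p q r : \bar R) (v : R).
Implicit Types T : (X -> \bar R) -> (X -> \bar R).

Lemma Lspace_pos0 r : r != 0 -> Lspace_pos mu r (cst 0).
Proof. by move=> r0; split => //; [rewrite Lnorm0|exact: nearW]. Qed.

Lemma Lspace_Lsum_l p q f : q != 0 -> Lspace_pos mu p f -> Lsum_pos mu p q f.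
Proof.
move=> q0 fp; exists f => //; exists (cst 0); first exact: Lspace_pos0.
by apply/funext => x /=; rewrite adde0.
Qed.

Lemma Lspace_Lsum_r p q f : p != 0 -> Lspace_pos mu q f -> Lsum_pos mu p q f.
Proof.
move=> p0 fq; exists (cst 0); first exact: Lspace_pos0.
by exists f => //; apply/funext => x /=; rewrite add0e.
Qed.

Lemma Lsum_pos_measurable p q f :
  Lsum_pos mu p q f -> measurable_fun [set: X] f.
Proof. by move=> [g [mg _ _]] [h [mh _ _]] <-; exact: emeasurable_funD. Qed.

Lemma Lsum_pos_ge0 p q f : Lsum_pos mu p q f -> \forall x \ae mu, 0 <= f x.
Proof.
move=> [g [_ _ g0]] [h [_ _ h0]] <-.
by apply: filterS2 g0 h0 => x; exact: adde_ge0.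
Qed.

Lemma le_measure_ae (A B : set X) : measurable A -> measurable B ->
  (\forall x \ae mu, A x -> B x) -> mu A <= mu B.
Proof.
move=> mA mB [N [mN N0 AB]].
apply: (@le_trans _ _ (mu (B `|` N))); last first.
  apply: le_trans (measureU2 _ mB mN) _.
  by rewrite [X in _ + X]N0 adde0.
apply: le_measure; rewrite ?inE//; first exact: measurableU.
move=> x Ax; have [Bx|Bx] := pselect (B x); [by left|right].
by apply: AB => /= /(_ Ax).
Qed.

(** Where |g| and |h| are both at most [v], so is their average; hence {|f| > v} lies, up to a null
    set, in the union of the other two superlevel sets. *)
Lemma distribution_fun_half_sum f g h v :
  measurable_fun [set: X] f -> measurable_fun [set: X] g ->
  measurable_fun [set: X] h ->
  (\forall x \ae mu, `|f x| <= 2^-1%:E * `|g x| + 2^-1%:E * `|h x|) ->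
  distribution_fun mu f v <=
  distribution_fun mu g v + distribution_fun mu h v.
Proof.
move=> mf mg mh fgh.
have mgv := measurable_superlevel v mg; have mhv := measurable_superlevel v mh.
apply: le_trans (measureU2 _ mgv mhv).
apply: le_measure_ae; [exact: measurable_superlevel|exact: measurableU|].
apply: filterS fgh => x fx /= vf; apply/orP; rewrite -[_ || _]negbK negb_or.
rewrite -!leNgt; apply/negP => /andP[gv hv]; move: vf; apply/negP.
rewrite -leNgt.
apply: (le_trans fx); rewrite [leRHS](_ : _ = 2^-1%:E * v%:E + 2^-1%:E * v%:E).
  by apply: leeD; rewrite lee_wpmul2l// lee_fin invr_ge0.
by rewrite -!EFinM -EFinD !(mulrC 2^-1%R) -splitr.
Qed.

Hypothesis muT_gt0 : 0 < mu [set: X].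

(** This is [weakLnorm_leP] with [M = C * 'N[mu]_r[f]] at the level [C * v]: the factor [C] cancels
    in the gauge, which is then the modular by [modularE]. *)
Lemma weak_type_modularP T r (C : R) : 0 < r -> (0 < C)%R ->
  (forall f, Lspace_pos mu r f -> measurable_fun [set: X] (T f)) ->
  (forall f, Lspace_pos mu r f -> weakLnorm mu r (T f) <= C%:E * 'N[mu]_r[f])
  <->
  (forall f, Lspace_pos mu r f -> forall v, (0 < v)%R ->
     distribution_fun mu (T f) (C * v) <= modular mu r v f).
Proof.
move=> r0 C0 mT; have CN0 : (C != 0)%R by rewrite gt_eqF.
have fin_norm f : Lspace_pos mu r f -> 'N[mu]_r[f] \is a fin_num.
  by move=> [_ ? _]; rewrite ge0_fin_numE ?Lnorm_ge0.
have gaugeE f v : Lspace_pos mu r f -> (0 < v)%R ->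
    gauge r ((C * v)^-1 * (C * fine 'N[mu]_r[f]))%:E = modular mu r v f.
  move=> fr v0; have [mf _ _] := fr; rewrite modularE//; congr gauge.
  rewrite -[in RHS](fineK (fin_norm _ fr)) -EFinM; congr EFin.
  by rewrite invfM mulrACA mulVf// mul1r.
have M0 f : (0 <= C * fine 'N[mu]_r[f])%R.
  by rewrite mulr_ge0 ?fine_ge0 ?Lnorm_ge0 ?ltW.
split=> [TC f fr v v0|TC f fr].
  rewrite -gaugeE//; move: (C * v)%R (mulr_gt0 C0 v0).
  apply/weakLnorm_leP => //; first exact: mT.
  by rewrite EFinM fineK ?fin_norm//; exact: TC.
rewrite -[X in C%:E * X](fineK (fin_norm _ fr)) -EFinM.
apply/weakLnorm_leP => //; first exact: mT.
move=> w w0; have wC0 : (0 < w / C)%R by rewrite divr_gt0.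
have wE : w = (C * (w / C))%R by rewrite mulrCA divff// mulr1.
by rewrite wE gaugeE//; exact: TC.
Qed.

End WeakType.

(** * Comparison of the distribution of [Theta] with modulars *)

(** As [p <= q], the integrand in [distribution_Theta] is pointwise the smaller of the two
    gauges. *)
Lemma distribution_Theta_le_modular (R : realType) (p q r : \bar R)
    (f : R -> \bar R) (v : R) : 0 < p -> p <= q -> r = p \/ r = q ->
  (0 < v)%R -> measurable_fun [set: R] f ->
  distribution_fun lambda2 (Theta p q f) v <= modular lambda r v f.
Proof.
move=> p0 pq rpq v0 mf; have q0 : 0 < q by exact: lt_le_trans pq.
rewrite distribution_Theta//; apply: ge0_le_integral => //.
- by move=> x _; exact: gauge_ge0.
- have := measurable_gauge_scale p v mf; have := measurable_gauge_scale q v mf.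
  move=> mq mp; rewrite [X in measurable_fun _ X](_ : _ = fun x =>
    if 1 < v^-1%:E * `|f x| then gauge p (v^-1%:E * `|f x|)
    else gauge q (v^-1%:E * `|f x|)); last by apply/funext => x; case: ifP.
  apply: measurable_fun_ifT => //; apply: measurable_fun_lte => //.
  by apply: measurable_funeM; exact: measurableT_comp.
- exact: measurable_gauge_scale.
move=> x _; have a0 := scaled_abse_ge0 f x v0.
case: ltP => a1; case: rpq => -> //.
  exact: le_gauge_exponent_gt1.
by apply: le_gauge_exponent_le1 => //; rewrite a0.
Qed.

(** Here [f] is cut at height [v]. At each point one of the two gauges is taken at 0 and vanishes,
    so the modulars add up. The pointwise alternative yields both the sum [f] and the sign of the
    two pieces. *)
Lemma distribution_Theta_split (R : realType) (p q : \bar R)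
    (f : R -> \bar R) (v : R) : 0 < p -> 0 < q -> (0 < v)%R ->
  measurable_fun [set: R] f ->
  exists f0 f1 : R -> \bar R,
    [/\ measurable_fun [set: R] f0, measurable_fun [set: R] f1,
        (forall x, f0 x = f x /\ f1 x = 0 \/ f0 x = 0 /\ f1 x = f x) &
        distribution_fun lambda2 (Theta p q f) v =
        modular lambda p v f0 + modular lambda q v f1].
Proof.
move=> p0 q0 v0 mf.
have mlt : measurable_fun [set: R] (fun x => 1 < v^-1%:E * `|f x|).
  apply: measurable_fun_lte => //.
  by apply: measurable_funeM; exact: measurableT_comp.
pose f0 x := if 1 < v^-1%:E * `|f x| then f x else 0.
pose f1 x := if 1 < v^-1%:E * `|f x| then 0 else f x.
have mf0 : measurable_fun [set: R] f0 by exact: measurable_fun_ifT.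
have mf1 : measurable_fun [set: R] f1 by exact: measurable_fun_ifT.
exists f0, f1; split => //.
  by move=> x; rewrite /f0 /f1; case: ifP => _; [left|right].
rewrite distribution_Theta// -ge0_integralD//.
- apply: eq_integral => x _; rewrite /f0 /f1.
  by case: ifP => _; rewrite abse0 mule0 gauge0// ?adde0 ?add0e.
- by move=> x _; exact: gauge_ge0.
- exact: measurable_gauge_scale.
- by move=> x _; exact: gauge_ge0.
- exact: measurable_gauge_scale.
Qed.

Theorem theorem3p8 (R : realType) (p q : \bar R)
    (p_gt0 : 0 < p) (le_pq : p <= q)
    (T : (R -> \bar R) -> (R -> \bar R))
    (T_S : forall f, Lsum_pos lambda p q f -> space_S lambda (T f))
    (T_subconvex : subconvex lambda (Lsum_pos lambda p q) T)
    (absT_subconvex : p < q ->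
       subconvex lambda (Lsum_pos lambda p q) (abs_operator T)) :
  (weak_type lambda T p /\ weak_type lambda T q)
  <->
  (exists2 alpha : R, (0 < alpha)%R &
     forall f, Lsum_pos lambda p q f ->
     forall v : R, (0 < v)%R ->
       distribution_fun lambda (T f) (alpha * v)
         <= distribution_fun lambda2 (Theta p q f) v).
Proof.
have q_gt0 : 0 < q by exact: lt_le_trans le_pq.
have pN0 : p != 0 by rewrite gt_eqF.
have qN0 : q != 0 by rewrite gt_eqF.
have lT : 0 < @lambda R [set: R] by rewrite lambda_setT ltry.
have mT f : Lsum_pos lambda p q f -> measurable_fun [set: R] (T f).
  by move=> /T_S[].
have mTp f : Lspace_pos lambda p f -> measurable_fun [set: R] (T f).
  by move=> /(Lspace_Lsum_l qN0)/mT.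
have mTq f : Lspace_pos lambda q f -> measurable_fun [set: R] (T f).
  by move=> /(Lspace_Lsum_r pN0)/mT.
split=> [[[Cp Cp0 Tp] [Cq Cq0 Tq]]|[alpha a0 Ta]]; last first.
  (* [alpha] itself serves as the constant of both weak types. *)
  split; exists alpha => //; apply/weak_type_modularP => // f fr v v0;
    have [mf _ _] := fr.
    apply: (le_trans (Ta _ (Lspace_Lsum_l qN0 fr) _ v0)).
    by apply: distribution_Theta_le_modular => //; left.
  apply: (le_trans (Ta _ (Lspace_Lsum_r pN0 fr) _ v0)).
  by apply: distribution_Theta_le_modular => //; right.
(* A common constant, so that both weak type estimates hold at the same level. *)
pose C := Num.max Cp Cq.
have C0 : (0 < C)%R by rewrite lt_max Cp0.
have {}Tp f : Lspace_pos lambda p f -> forall v, (0 < v)%R ->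
    distribution_fun lambda (T f) (C * v) <= modular lambda p v f.
  move: f; apply/weak_type_modularP => // f fp; apply: (le_trans (Tp f fp)).
  by rewrite lee_wpmul2r ?Lnorm_ge0// lee_fin le_max lexx.
have {}Tq f : Lspace_pos lambda q f -> forall v, (0 < v)%R ->
    distribution_fun lambda (T f) (C * v) <= modular lambda q v f.
  move: f; apply/weak_type_modularP => // f fq; apply: (le_trans (Tq f fq)).
  by rewrite lee_wpmul2r ?Lnorm_ge0// lee_fin le_max lexx orbT.
(* For [p = q] the distribution of [Theta] is exactly the p-modular, and the weak type estimate
   applies to [f] itself. *)
move: le_pq; rewrite le_eqVlt => /predU1P[pq|lt_pq].
  exists C => // f fD v v0; have mf := Lsum_pos_measurable fD.
  have -> : distribution_fun lambda2 (Theta p q f) v = modular lambda p v f.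
    by rewrite distribution_Theta// -pq; apply: eq_integral => x _; case: ifP.
  have [/(modular_lty_Lspace lT p_gt0 v0 mf (Lsum_pos_ge0 fD)) fp|] :=
    ltP (modular lambda p v f) +oo; first exact: Tp.
  by rewrite leye_eq => /eqP ->; rewrite leey.
(* The factor 2 comes from writing [f] as the average of [g0 = 2 f0] and [g1 = 2 f1]: their modulars
   at level [2 * v] are those of [f0] and [f1] at level [v]. *)
exists (C * 2)%R => [|f fD v v0]; first by rewrite mulr_gt0.
have mf := Lsum_pos_measurable fD.
have [f0 [f1 [mf0 mf1 f01 ->]]] := distribution_Theta_split p_gt0 q_gt0 v0 mf.
have two0 : (0 < 2 :> R)%R by [].
have v20 : (0 < 2 * v)%R by rewrite mulr_gt0.
pose g0 x := 2%:E * f0 x; pose g1 x := 2%:E * f1 x.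
rewrite -(modular_scale lambda p f0 two0 v0).
rewrite -(modular_scale lambda q f1 two0 v0).
rewrite -/g0 -/g1.
have m0 r (g : R -> \bar R) : 0 <= modular lambda r (2 * v) g.
  by apply: integral_ge0 => x _; exact: gauge_ge0.
(* If one modular is infinite, so is the right-hand side, the other one being nonnegative. If both
   are finite, [g0] lies in L^p and [g1] in L^q. *)
have [g0oo|] := ltP (modular lambda p (2 * v) g0) +oo; last first.
  by rewrite leye_eq => /eqP ->; rewrite addye ?leey// gt_eqF//
    (lt_le_trans _ (m0 _ _)).
have [g1oo|] := ltP (modular lambda q (2 * v) g1) +oo; last first.
  by rewrite leye_eq => /eqP ->; rewrite addey ?leey// gt_eqF//
    (lt_le_trans _ (m0 _ _)).
have fge0 := Lsum_pos_ge0 fD.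
have mg0 : measurable_fun [set: R] g0 by exact: measurable_funeM.
have mg1 : measurable_fun [set: R] g1 by exact: measurable_funeM.
have g0ge0 : \forall x \ae lambda, 0 <= g0 x.
  apply: filterS fge0 => x fx; rewrite /g0.
  by case: (f01 x) => -[-> _]; rewrite ?mule0// mule_ge0.
have g1ge0 : \forall x \ae lambda, 0 <= g1 x.
  apply: filterS fge0 => x fx; rewrite /g1.
  by case: (f01 x) => -[_ ->]; rewrite ?mule0// mule_ge0.
have g0p := modular_lty_Lspace lT p_gt0 v20 mg0 g0ge0 g0oo.
have g1q := modular_lty_Lspace lT q_gt0 v20 mg1 g1ge0 g1oo.
have g0D := Lspace_Lsum_l qN0 g0p; have g1D := Lspace_Lsum_r pN0 g1q.
apply: (@le_trans _ _ (distribution_fun lambda (T g0) (C * (2 * v)) +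
                       distribution_fun lambda (T g1) (C * (2 * v)))).
  rewrite -mulrA; apply: distribution_fun_half_sum; try exact: mT.
  have half : (0 <= (2^-1 : R) <= 1)%R.
    by rewrite invr_ge0 ler0n invf_le1// ler1n.
  have := absT_subconvex lt_pq g0 g1 2^-1%R g0D g1D half.
  have onem_half : (1 - 2^-1 = 2^-1 :> R)%R.
    by rewrite {1}(splitr 1) mul1r addrK.
  rewrite onem_half.
  (* The identity has to hold at every point, because [T] need not respect a.e. equality. *)
  have -> : (fun y => 2^-1%:E * g0 y + 2^-1%:E * g1 y) = f.
    apply/funext => x; rewrite /g0 /g1 !muleA -!EFinM mulVf// !mul1e.
    by case: (f01 x) => -[-> ->]; rewrite ?adde0 ?add0e.
  by [].
by apply: leeD; [exact: Tp|exact: Tq].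
Qed.
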